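(* If $\tau=1000$ or $\tau=1100$, then $$f_\tau(x)=\frac{(1-x)(1-8x+24x^2-31x^3+13x^4+2x^5+2x^6)}{(1-2x)^5}$$ as formal power series in $x$, where $f_\tau(x)=\sum_{n\ge 0} b_n(\tau)x^n$ and $b_n(\tau)$ is the number of ascent sequences of length $n$ that avoid both patterns $021$ and $\tau$.
   Context: For a finite sequence $w=w_1\cdots w_n$ of integers, $\mathrm{asc}(w)$ is the number of indices $1\le i\le n-1$ with $w_i<w_{i+1}$. An ascent sequence of length $n\ge 1$ is a sequence $a_1\cdots a_n$ of non-negative integers such that $a_1=0$ and $a_i\le \mathrm{asc}(a_1\cdots a_{i-1})+1$ for $1<i\le n$; there is exactly one (empty) ascent sequence of length $0$. A sequence $\pi=\pi_1\cdots\pi_n$ contains a pattern $\tau=\tau_1\cdots\tau_m$ if there are indices $1\le i_1<\cdots<i_m\le n$ such that for all $j,k\in\{1,\dots,m\}$: $\pi_{i_j}<\pi_{i_k}$ iff $\tau_j<\tau_k$, and $\pi_{i_j}=\pi_{i_k}$ iff $\tau_j=\tau_k$; otherwise $\pi$ avoids $\tau$. For a pattern $\tau$, $B_n(\tau)$ is the set of ascent sequences of length $n$ avoiding both $021$ and $\tau$ (with $B_0(\tau)$ consisting of the empty sequence), and $b_n(\tau)=|B_n(\tau)|$. *)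

(* Defs.v *)
From mathcomp Require Import all_boot all_order all_algebra.

Set Implicit Arguments.
Unset Strict Implicit.
Unset Printing Implicit Defensive.

Import GRing.Theory.

Definition asc (w : seq nat) : nat :=
  \sum_(i < (size w).-1) (nth 0 w i < nth 0 w i.+1).

(* Positions are counted from 0, so the letters before position i form
   take i a; the empty sequence qualifies vacuously. *)
Definition is_ascent_seq (a : seq nat) : bool :=
  [forall i : 'I_(size a),
     if i == 0 :> nat then nth 0 a i == 0
     else nth 0 a i <= asc (take i a) + 1].

Definition contains (p t : seq nat) : bool :=
  [exists f : {ffun 'I_(size t) -> 'I_(size p)},
     [forall j : 'I_(size t), forall k : 'I_(size t),
        [&& (j < k) ==> (f j < f k),
            (nth 0 p (f j) < nth 0 p (f k)) == (nth 0 t j < nth 0 t k) &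
            (nth 0 p (f j) == nth 0 p (f k)) == (nth 0 t j == nth 0 t k)]]].

Definition avoids (p t : seq nat) : bool := ~~ contains p t.

(* The letters of an ascent sequence of length n are all smaller than n
   (is_ascent_seq_bound), so tuples over 'I_n miss nothing; see avoidersP. *)
Definition avoiders (t : seq nat) (n : nat) : {set n.-tuple 'I_n} :=
  [set a : n.-tuple 'I_n |
     let s := [seq val i | i <- a] in
     [&& is_ascent_seq s, avoids s [:: 0; 2; 1] & avoids s t]].

Lemma asc_le (w : seq nat) : asc w <= (size w).-1.
Proof.
rewrite -[leqRHS]card_ord -sum1_card; apply: leq_sum => i _.
by case: (_ < _).
Qed.

Lemma is_ascent_seq_bound (a : seq nat) :
  is_ascent_seq a -> all (fun x => x < size a) a.
Proof.
move=> /forallP aP; apply/(all_nthP 0) => i lt_i.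
have := aP (Ordinal lt_i) => /=.
case: i lt_i => [|i] lt_i /=; first by move=> /eqP ->.
move=> /leq_ltn_trans; apply.
have := asc_le (take i.+1 a); rewrite size_takel ?(ltnW lt_i) //= => le_i.
by rewrite addn1; apply: leq_ltn_trans lt_i.
Qed.

Lemma avoidersP (t : seq nat) (n : nat) (s : seq nat) :
  (exists2 a, a \in avoiders t n & [seq val i | i <- a] = s) <->
  [/\ size s = n, is_ascent_seq s, avoids s [:: 0; 2; 1] & avoids s t].
Proof.
split=> [[a] | [sz_s s_asc s_021 s_t]].
  rewrite inE => /and3P[a_asc a_021 a_t] <-.
  by split=> //; rewrite size_map size_tuple.
have s_lt : all (fun x => x < n) s by rewrite -sz_s is_ascent_seq_bound.
have val_s : [seq val i | i <- (pmap insub s : seq 'I_n)] = s.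
  rewrite pmap_filter; last by move=> x; apply: insubK.
  by apply/all_filterP; apply: sub_all s_lt => x lt_x; rewrite insubT.
have sz_r : size (pmap insub s : seq 'I_n) == n.
  by rewrite -(size_map val) val_s sz_s.
by exists (Tuple sz_r); rewrite ?inE /= val_s // s_asc s_021 s_t.
Qed.

Local Open Scope ring_scope.

(* A formal power series is its sequence of coefficients. *)
Definition fps (R : Type) := nat -> R.

Definition fps_poly (R : nzRingType) (p : {poly R}) : fps R := fun n => p`_n.

Definition fps_mul (R : nzRingType) (f g : fps R) : fps R :=
  fun n => \sum_(i < n.+1) f i * g (n - i)%N.

(* First n coefficients of 1 / g, by solving g * h = 1 for one coefficient
   after another. *)
Fixpoint fps_inv_seq (R : fieldType) (g : fps R) (n : nat) : seq R :=
  if n is m.+1 then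
    let h := fps_inv_seq g m in
    rcons h ((g 0%N)^-1 * ((m == 0%N)%:R - \sum_(k < m) h`_k * g (m - k)%N))
  else [::].

(* Meaningful only if g 0 != 0. *)
Definition fps_inv (R : fieldType) (g : fps R) : fps R :=
  fun n => (fps_inv_seq g n.+1)`_n.

Definition fps_div (R : fieldType) (f g : fps R) : fps R :=
  fps_mul f (fps_inv g).

Lemma size_fps_inv_seq (R : fieldType) (g : fps R) (n : nat) :
  size (fps_inv_seq g n) = n.
Proof. by elim: n => //= n IHn; rewrite size_rcons IHn. Qed.

Lemma nth_fps_inv_seq (R : fieldType) (g : fps R) (n k : nat) :
  (k < n)%N -> (fps_inv_seq g n)`_k = fps_inv g k.
Proof.
elim: n => // n IHn; rewrite ltnS leq_eqVlt => /predU1P[-> // | lt_kn].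
by rewrite /= nth_rcons size_fps_inv_seq lt_kn IHn.
Qed.

Lemma fps_mulVf (R : fieldType) (g : fps R) :
  g 0%N != 0 -> fps_mul (fps_inv g) g =1 fps_poly 1.
Proof.
move=> g0 n; rewrite /fps_mul /fps_poly coef1 big_ord_recr /= subnn.
rewrite {2}/fps_inv /= nth_rcons size_fps_inv_seq ltnn eqxx.
under [X in _ - X]eq_bigr => k _ do rewrite nth_fps_inv_seq //.
by rewrite mulrAC mulVf // mul1r addrC subrK.
Qed.

Definition avoiders_gf (t : seq nat) : fps rat :=
  fun n => #|avoiders t n|%:R.

(* Main.v *)
(** An ascent sequence avoids 021 iff its nonzero letters increase weakly, and
    then the small letter in an occurrence of 1000 or 1100 must be 0: avoiding
    1000 means having at most two zeros after the first nonzero letter, and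
    avoiding 1100 means having at most one zero after the first repetition of a
    nonzero letter.  Let the slack be the number of ascents minus the largest
    letter.  It can only grow right after a zero, and then by at most 1; for
    1100 it stays 0 until a repetition occurs.  Hence in both cases the
    sequences are counted by a transfer matrix with finitely many states, whose
    only nonzero eigenvalue, after the first nonzero letter, is 2.  The two
    matrices give the same counts: 2^n times a polynomial of degree 4 in n. *)

Require Import Defs.
From mathcomp Require Import all_boot all_order all_algebra zify ring.

Set Implicit Arguments.
Unset Strict Implicit.
Unset Printing Implicit Defensive.

Import GRing.Theory.

(** * Pattern containment through subsequences *)

Lemma subseq_map_nth (T : eqType) (x0 : T) (p : seq T) (idx : seq nat) :
  sorted ltn idx -> all (gtn (size p)) idx -> subseq (map (nth x0 p) idx) p.
Proof.
move=> idx_sorted /allP idx_lt; rewrite -[X in subseq _ X](mkseq_nth x0 p).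
apply: map_subseq.
have -> : idx = filter (mem idx) (iota 0 (size p)).
  apply: (irr_sorted_eq ltn_trans ltnn) => //.
    by apply: sorted_filter (iota_ltn_sorted _ _); apply: ltn_trans.
  move=> i; rewrite mem_filter mem_iota /=.
  by case: (boolP (i \in idx)) => // /idx_lt.
exact: filter_subseq.
Qed.

Lemma subseq_nth (T : eqType) (x0 : T) (u p : seq T) :
  subseq u p ->
  exists2 idx, sorted ltn idx /\ all (gtn (size p)) idx &
    u = map (nth x0 p) idx.
Proof.
case/subseqP => m sz_m ->; exists (mask m (iota 0 (size p))).
  split.
    apply: (subseq_sorted ltn_trans (mask_subseq _ _)).
    exact: iota_ltn_sorted.
  by apply/allP => i /mem_mask; rewrite mem_iota.
by rewrite map_mask map_nth_iota0 // take_size.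
Qed.

(** Comparing by [<] in both directions also settles equality, so an occurrence is a subsequence
    with the same strict comparisons as [t]. *)
Lemma containsP (p t : seq nat) :
  reflect (exists2 u, subseq u p &
             size u = size t /\ forall j k, j < size t -> k < size t ->
               (nth 0 u j < nth 0 u k) = (nth 0 t j < nth 0 t k))
          (contains p t).
Proof.
apply: (iffP existsP) => [[f /forallP fP] | [u u_p [sz_u uP]]].
  have {}fP (j k : 'I_(size t)) : [/\ j < k -> f j < f k,
      (nth 0 p (f j) < nth 0 p (f k)) = (nth 0 t j < nth 0 t k) &
      (nth 0 p (f j) == nth 0 p (f k)) = (nth 0 t j == nth 0 t k)].
    by have /forallP/(_ k)/and3P[/implyP ? /eqP ? /eqP ?] := fP j.
  (* The default 0 is never read: [g] is only applied to positions of [t]. *)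
  pose g i := if insub i is Some j then f j : nat else 0.
  have gE (j : 'I_(size t)) : g j = f j by rewrite /g valK.
  exists (map (nth 0 p) (map g (iota 0 (size t)))).
    apply: subseq_map_nth; last first.
      apply/allP => x /mapP[i]; rewrite mem_iota /= add0n => lt_i ->.
      by rewrite -[i]/(val (Ordinal lt_i)) gE.
    rewrite sorted_map; apply: (@sub_in_sorted _ (gtn (size t)) ltn).
    - move=> i j /= lt_i lt_j lt_ij /=.
      rewrite -[i]/(val (Ordinal lt_i)) -[j]/(val (Ordinal lt_j)) !gE.
      by have [h _ _] := fP (Ordinal lt_i) (Ordinal lt_j); apply: h.
    - by apply/allP => i; rewrite mem_iota.
    - exact: iota_ltn_sorted.
  rewrite !size_map size_iota; split=> // j k lt_j lt_k.
  rewrite -map_comp !(nth_map 0) ?size_iota //= !nth_iota // !add0n.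
  rewrite -[j]/(val (Ordinal lt_j)) -[k]/(val (Ordinal lt_k)) !gE.
  by case: (fP (Ordinal lt_j) (Ordinal lt_k)).
have [idx [idx_sorted /allP idx_lt] def_u] := subseq_nth 0 u_p.
have sz_idx : size idx = size t by rewrite -sz_u def_u size_map.
have lt_f (j : 'I_(size t)) : nth 0 idx j < size p.
  by apply: idx_lt; rewrite mem_nth ?sz_idx.
exists [ffun j => Ordinal (lt_f j)].
apply/forallP => j; apply/forallP => k; rewrite !ffunE /=.
have uE i : i < size t -> nth 0 p (nth 0 idx i) = nth 0 u i.
  by move=> lt_i; rewrite def_u (nth_map 0) ?sz_idx.
rewrite !uE // uP // eqxx /=; apply/andP; split.
  apply/implyP => lt_jk.
  by apply: (sorted_ltn_nth ltn_trans); rewrite // inE sz_idx.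
have := uP j k (ltn_ord j) (ltn_ord k); have := uP k j (ltn_ord k) (ltn_ord j).
by case: ltngtP => _; case: ltngtP.
Qed.

Lemma contains021P (p : seq nat) :
  reflect (exists x y z, x < z < y /\ subseq [:: x; y; z] p)
          (contains p [:: 0; 2; 1]).
Proof.
apply: (iffP (containsP _ _)) => [[u u_p [sz_u uP]]
                                 | [x [y [z [/andP[xz zy] u_p]]]]].
  case: u u_p sz_u uP => [|x [|y [|z []]]] // u_p _ uP.
  exists x, y, z; split=> //; apply/andP; split.
    exact: (uP 0 2).
  exact: (uP 2 1).
exists [:: x; y; z] => //; split=> // -[|[|[|j]]] [|[|[|k]]] //= _ _; lia.
Qed.

Lemma contains1000P (p : seq nat) :
  reflect (exists x y, y < x /\ subseq [:: x; y; y; y] p)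
          (contains p [:: 1; 0; 0; 0]).
Proof.
apply: (iffP (containsP _ _)) => [[u u_p [sz_u uP]]
                                 | [x [y [yx u_p]]]].
  case: u u_p sz_u uP => [|x [|y [|z [|t []]]]] // u_p _ uP.
  move: (uP 1 2 isT isT) (uP 2 1 isT isT) (uP 1 3 isT isT) (uP 3 1 isT isT).
  move: (uP 1 0 isT isT) => /= h1 h2 h3 h4 h5.
  have ez : z = y by lia.
  have et : t = y by lia.
  by exists x, y; split; [lia | rewrite ez et in u_p].
exists [:: x; y; y; y] => //; split=> //.
move=> [|[|[|[|j]]]] [|[|[|[|k]]]] //= _ _; lia.
Qed.

Lemma contains1100P (p : seq nat) :
  reflect (exists x y, y < x /\ subseq [:: x; x; y; y] p)
          (contains p [:: 1; 1; 0; 0]).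
Proof.
apply: (iffP (containsP _ _)) => [[u u_p [sz_u uP]]
                                 | [x [y [yx u_p]]]].
  case: u u_p sz_u uP => [|x [|y [|z [|t []]]]] // u_p _ uP.
  move: (uP 0 1 isT isT) (uP 1 0 isT isT) (uP 2 3 isT isT) (uP 3 2 isT isT).
  move: (uP 2 0 isT isT) => /= h1 h2 h3 h4 h5.
  have ey : y = x by lia.
  have et : t = z by lia.
  by exists x, z; split; [lia | rewrite ey et in u_p].
exists [:: x; x; y; y] => //; split=> //.
move=> [|[|[|[|j]]]] [|[|[|[|k]]]] //= _ _; lia.
Qed.

(** * The ascent condition letter by letter, and avoidance of 021 *)

(* [s] may follow a prefix that has [a] ascents and ends with [l]. *)
Fixpoint asc_ok (a l : nat) (s : seq nat) : bool :=
  if s is x :: s' then (x <= a + 1) && asc_ok (a + (l < x)) x s' else true.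

Definition nonzeros (s : seq nat) : seq nat := [seq x <- s | 0 < x].

Lemma asc_cons2 (x y : nat) (s : seq nat) :
  asc [:: x, y & s] = (x < y) + asc (y :: s).
Proof. by rewrite /asc /= big_ord_recl. Qed.

Lemma asc_okP (a l : nat) (s : seq nat) :
  reflect (forall i, i < size s -> nth 0 s i <= a + asc (l :: take i s) + 1)
          (asc_ok a l s).
Proof.
elim: s a l => [|x s IHs] a l /=; first by apply: ReflectT.
apply: (iffP andP) => [[le_x /IHs sP] [|i] /= lt_i | sP].
- by rewrite /asc big_ord0 addn0.
- by rewrite asc_cons2 addnA; apply: sP.
split; first by have := sP 0 isT; rewrite /asc big_ord0 addn0.
by apply/IHs => i lt_i; have := sP i.+1 lt_i; rewrite /= asc_cons2 addnA.
Qed.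

Lemma is_ascent_seq_cons (x : nat) (s : seq nat) :
  is_ascent_seq (x :: s) = (x == 0) && asc_ok 0 0 s.
Proof.
apply/forallP/andP => [sP | [/eqP-> /asc_okP sP] [[|i] //= lt_i]]; last first.
  by apply: sP.
have /eqP x0 : x == 0 := sP ord0; rewrite x0 eqxx; split=> //.
apply/asc_okP => i lt_i.
have := sP (Ordinal (lt_i : i.+1 < size (x :: s))).
by rewrite /= x0.
Qed.

Lemma sorted_leqP (s : seq nat) :
  reflect (forall y z, subseq [:: y; z] s -> y <= z) (sorted leq s).
Proof.
apply: (iffP idP) => [s_sorted y z /(subseq_sorted leq_trans)/(_ s_sorted) | ].
  by rewrite /= andbT.
elim: s => //= x s IHs sP; case: s => [|y s] // in IHs sP *.
apply/andP; split; first by apply: sP; rewrite /= !eqxx sub0seq.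
apply: IHs => u v uv_s; apply: sP.
exact: subseq_trans uv_s (subseq_cons _ _).
Qed.

(** The leading 0 turns every descent between nonzero letters into a 021; conversely, the last two
    letters of a 021 are nonzero and descend. *)
Lemma avoids021 (s : seq nat) :
  avoids (0 :: s) [:: 0; 2; 1] = sorted leq (nonzeros s).
Proof.
apply/negP/sorted_leqP => [s_av y z |
                           sP /contains021P[x [y [z [/andP[lt_xz lt_zy] ]]]]].
  rewrite subseq_filter => /andP[/and3P[y0 z0 _] yz_s].
  rewrite leqNgt; apply/negP => lt_zy; case: s_av.
  by apply/contains021P; exists 0, y, z; rewrite z0 lt_zy /= yz_s.
move=> xyz_s; have yz_s : subseq [:: y; z] s.
  by move: xyz_s => /=; case: eqP => // _ /cons_subseq.
suff : y <= z by lia.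
by apply: sP; rewrite subseq_filter yz_s /= andbT; lia.
Qed.

(* With the nonzero letters weakly increasing, the repeated small letter of
   1000 or 1100 can only be 0. *)
Lemma subseq_descent (x y : nat) (s : seq nat) :
  sorted leq (nonzeros s) -> y < x -> subseq [:: x; y] s -> y = 0.
Proof.
move=> /sorted_leqP sP lt_yx xy_s; case: (posnP y) => // y0.
suff : x <= y by lia.
by apply: sP; rewrite subseq_filter xy_s /= andbT; lia.
Qed.

Lemma subseq_nseq (T : eqType) (x : T) (k : nat) (s : seq T) :
  subseq (nseq k x) s = (k <= count_mem x s).
Proof.
elim: s k => [|y s IHs] [|k] //=.
rewrite eq_sym -[_ :: nseq _ _]/(nseq k.+1 x).
by case: eqP => _; rewrite IHs.
Qed.

(** * Criteria for avoiding 1000 and 1100 *)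

Fixpoint ok1000 (s : seq nat) : bool :=
  if s is x :: s' then
    if x == 0 then ok1000 s' else count_mem 0 s' <= 2
  else true.

(* [m] is the last nonzero letter read, or 0 if there is none yet. *)
Fixpoint ok1100 (m : nat) (s : seq nat) : bool :=
  if s is x :: s' then
    if x == 0 then ok1100 m s'
    else if x == m then count_mem 0 s' <= 1
    else ok1100 x s'
  else true.

(** The first nonzero letter is the best choice for the large letter of 1000, since the most zeros
    follow it. *)
Lemma ok1000P (s : seq nat) :
  reflect (exists2 x, 0 < x & subseq [:: x; 0; 0; 0] s) (~~ ok1000 s).
Proof.
elim: s => [|y s IHs] /=; first by constructor=> -[].
case: (posnP y) => [-> | y0] /=.
  apply: (iffP IHs) => -[x x0 x_s]; exists x => //; first by rewrite gtn_eqF.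
  by rewrite gtn_eqF in x_s.
rewrite -ltnNge -(subseq_nseq 0 3).
apply: (iffP idP) => [s3 | [x x0]]; first by exists y; rewrite ?eqxx.
by case: eqP => // _ /cons_subseq.
Qed.

(** The first alternative covers an occurrence whose first letter is the [m] read before [s]. As
    nonzero letters increase weakly, equal ones are consecutive among them, so comparing with the
    last one detects every repetition. *)
Lemma ok1100P (m : nat) (s : seq nat) : path leq m (nonzeros s) ->
  reflect ((0 < m /\ subseq [:: m; 0; 0] s) \/
           exists2 x, 0 < x & subseq [:: x; x; 0; 0] s)
          (~~ ok1100 m s).
Proof.
elim: s m => [|y s IHs] m /=; first by constructor=> -[[]|[]].
case: (posnP y) => [-> | y0] /=.
  move/IHs => {}IHs; apply: (iffP IHs) => -[[m0 m_s]|[x x0 x_s]].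
  - by left; rewrite gtn_eqF.
  - by right; exists x => //; rewrite gtn_eqF.
  - by left; rewrite gtn_eqF in m_s.
  - by right; exists x => //; rewrite gtn_eqF in x_s.
move=> /andP[le_my y_s].
case: (eqVneq y m) => [eym | neq_ym].
  rewrite -eym -ltnNge -(subseq_nseq 0 2); apply: (iffP idP) => [s2|].
    by left; rewrite ?eqxx.
  case=> [[_]|[x x0]]; first by rewrite ?eqxx.
  by case: eqP => [_ /cons_subseq // | _ /cons_subseq/cons_subseq].
apply: (iffP (IHs y y_s)) => -[].
- by case=> _ y00_s; right; exists y; rewrite ?eqxx.
- case=> x x0 x_s; right; exists x => //.
  by case: eqP => // _; apply: cons_subseq x_s.
- case=> m0 m_s.
  (* Later nonzero letters are at least [y > m], so [m] cannot return. *)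
  have : m \in nonzeros s by rewrite mem_filter m0 (mem_subseq m_s) // mem_head.
  move: y_s; rewrite (path_sortedE leq_trans) => /andP[/allP yP _] /yP; lia.
- case=> x x0; case: eqP => [-> | _] x_s; first by left.
  by right; exists x.
Qed.

Lemma subseq_cons0 (x : nat) (u s : seq nat) :
  0 < x -> subseq (x :: u) (0 :: s) = subseq (x :: u) s.
Proof. by move=> x0; rewrite /= gtn_eqF. Qed.

Lemma avoids1000 (s : seq nat) :
  sorted leq (nonzeros s) -> avoids (0 :: s) [:: 1; 0; 0; 0] = ok1000 s.
Proof.
move=> s_sorted; rewrite -[ok1000 s]negbK; congr (~~ _).
apply/contains1000P/ok1000P => [[x [y [lt_yx]]] | [x x0 x_s]].
  have x0 : 0 < x by lia.
  rewrite subseq_cons0 // => x_s; exists x => //.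
  suff y0 : y = 0 by rewrite y0 in x_s.
  apply: (subseq_descent s_sorted lt_yx); apply: subseq_trans x_s.
  by rewrite /= !eqxx.
by exists x, 0; rewrite subseq_cons0.
Qed.

Lemma avoids1100 (s : seq nat) :
  sorted leq (nonzeros s) -> avoids (0 :: s) [:: 1; 1; 0; 0] = ok1100 0 s.
Proof.
move=> s_sorted; have s_path : path leq 0 (nonzeros s).
  by rewrite path_min_sorted //; apply/allP.
rewrite -[ok1100 _ s]negbK; congr (~~ _).
apply/contains1100P/(ok1100P s_path) => [[x [y [lt_yx]]] | ].
  have x0 : 0 < x by lia.
  rewrite subseq_cons0 // => x_s; right; exists x => //.
  suff y0 : y = 0 by rewrite y0 in x_s.
  apply: (subseq_descent s_sorted lt_yx); apply: subseq_trans x_s.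
  by rewrite /= eqxx; case: eqP => //; rewrite !eqxx.
by case=> [[]//|[x x0 x_s]]; exists x, 0; rewrite subseq_cons0.
Qed.

(** * Counting words by their first letter *)

Definition counted (Q : pred (seq nat)) (n c : nat) : Prop :=
  exists2 L : seq (seq nat), uniq L /\ size L = c &
    forall s, (s \in L) = (size s == n) && Q s.

Lemma counted0 (Q : pred (seq nat)) : Q [::] -> counted Q 0 1.
Proof.
move=> Q0; exists [:: [::]] => // -[|x s]; first by rewrite mem_head.
by rewrite inE.
Qed.

Lemma counted_cons (Q : pred (seq nat)) (n : nat) (xs : seq nat)
    (Q' : nat -> pred (seq nat)) (c : nat -> nat) :
  uniq xs -> (forall x s, Q (x :: s) = (x \in xs) && Q' x s) ->
  (forall x, x \in xs -> counted (Q' x) n (c x)) ->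
  counted Q n.+1 (\sum_(x <- xs) c x).
Proof.
move=> xs_uniq QE cP.
(* Stated with [head] and [behead], the claim allows induction on [xs]. The default head 0 concerns
   only the empty word, which has the wrong length. *)
suff [L L_uniq LP] : counted
    (fun s => (head 0 s \in xs) && Q' (head 0 s) (behead s))
    n.+1 (\sum_(x <- xs) c x).
  by exists L => // -[|x s]; rewrite LP //= QE.
elim: xs xs_uniq cP {QE} => [|x xs IHs] /=.
  by exists [::]; rewrite ?big_nil // => s; rewrite andbF.
move=> /andP[x_xs xs_uniq] cP.
have [y y_xs|L [uL szL] LP] := IHs xs_uniq.
  by apply: cP; rewrite inE y_xs orbT.
have [M [uM szM] MP] := cP x (mem_head _ _).
exists (map (cons x) M ++ L).
  rewrite size_cat size_map big_cons szL szM; split=> //.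
  rewrite cat_uniq map_inj_uniq ?uM ?uL; last by move=> u v [].
  rewrite andbT /=; apply/hasPn => s; rewrite LP => /and3P[_ s_xs _].
  by apply: contra x_xs => /mapP[u _ def_s]; rewrite def_s in s_xs.
case=> [|y s]; rewrite mem_cat LP /= ?orbF; first by apply/mapP => -[].
rewrite eqSS inE; case: (eqVneq y x) => [-> | neq_yx] /=.
  by rewrite mem_map ?MP; [rewrite (negPf x_xs) andbF orbF | move=> u v []].
by case: mapP => // -[u _ [eyx _]]; rewrite eyx eqxx in neq_yx.
Qed.

(* Number of ways to extend by [n] letters an ascent sequence with largest
   letter [m > 0] and [m + e] ascents, ending with 0 if [b] and with [m]
   otherwise, by at most [k] zeros and weakly increasing nonzero letters.
   A letter [m + j] (with [j <= e + 1]) leads to slack [e + 1 - j] if it makes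
   an ascent and to slack [e] otherwise; so the slack increases only directly
   after a zero, by at most 1. *)
Fixpoint tail_count (k : nat) (b : bool) (e n : nat) : nat :=
  if n is n'.+1 then
    \sum_(j < e.+2) tail_count k false (if b || (0 < j) then e.+1 - j else e) n'
      + (if k is k'.+1 then tail_count k' true e n' else 0)
  else 1.

Definition tail_ok (k a l m : nat) (s : seq nat) : bool :=
  [&& asc_ok a l s, path leq m (nonzeros s) & count_mem 0 s <= k].

Lemma tail_countS (k e n : nat) (b : bool) :
  tail_count k b e n.+1 =
    \sum_(j < e.+2) tail_count k false (if b || (0 < j) then e.+1 - j else e) n
      + (if k is k'.+1 then tail_count k' true e n else 0).
Proof. by []. Qed.

Lemma counted_tail (k e l m n : nat) : 0 < m -> l \in [:: 0; m] ->
  counted (tail_ok k (m + e) l m) n (tail_count k (l == 0) e n).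
Proof.
elim: n k e l m => [|n IHn] k e l m m0 l_m; first exact: counted0.
(* Candidates for the next letter: 0 if a zero is still allowed, and [m] up to [m + e + 1], one more
   than the number of ascents. *)
pose xs := (if 0 < k then [:: 0] else [::]) ++ iota m e.+2.
pose Q' x := if x == 0 then tail_ok k.-1 (m + e) 0 m
             else tail_ok k (m + e + (l < x)) x x.
pose c x := if x == 0 then tail_count k.-1 true e n else
  tail_count k false (if (l == 0) || (m < x) then m + e.+1 - x else e) n.
have -> : tail_count k (l == 0) e n.+1 = \sum_(x <- xs) c x.
  have -> : \sum_(x <- xs) c x =
      \sum_(x <- iota m e.+2) c x
        + (if k is k'.+1 then tail_count k' true e n else 0).
    rewrite /xs big_cat; apply: etrans (addnC _ _) _; congr (_ + _).
    by rewrite /c; case: (k) => [|k']; rewrite ?big_nil // big_seq1.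
  rewrite tail_countS; congr (_ + _).
  rewrite -[m in iota m _]addn0 iotaDl big_map.
  rewrite -[iota 0 _]/(index_iota 0 e.+2) big_mkord; apply: eq_bigr => j _.
  have mj : m + j == 0 = false by lia.
  by rewrite /c mj subnDl -[X in X < m + j]addn0 ltn_add2l.
apply: (counted_cons (Q' := Q')).
- rewrite cat_uniq iota_uniq andbT; apply/andP; split; first by case: (0 < k).
  apply/hasPn => x; rewrite mem_iota => /andP[le_mx _].
  by case: (0 < k); rewrite ?inE //; lia.
- move=> x s; rewrite /xs /Q' mem_cat mem_iota /tail_ok /=.
  case: (posnP x) => [-> | x0] /=.
    rewrite addn0 [m <= 0]leqNgt m0 orbF.
    by case: (k) => [|k'] //=; rewrite !andbF.
  have -> : (x \in (if 0 < k then [:: 0] else [::])) = false.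
    by case: (0 < k); rewrite ?inE // gtn_eqF.
  rewrite add0n /=.
  have -> : (m <= x < m + e.+2) = (x <= m + e + 1) && (m <= x) by lia.
  by case: (x <= _); case: (m <= x); rewrite /= ?andbF.
move=> x; rewrite /xs mem_cat mem_iota /Q' /c; case: (posnP x) => [_ _ | x0].
  (* The flag takes the form [l == 0] of the induction hypothesis, with last letter 0. *)
  by rewrite -[true]/(0 == 0); apply: IHn; rewrite // mem_head.
have -> : (x \in (if 0 < k then [:: 0] else [::])) = false.
  by case: (0 < k); rewrite ?inE // gtn_eqF.
move=> /= x_m; rewrite -[false](gtn_eqF x0).
(* [e'] is the slack after reading [x], which is the new largest letter. *)
set e' := if _ then _ else _.
have -> : m + e + (l < x) = x + e'.
  move: l_m; rewrite /e' !inE => /orP[] /eqP ->; first by rewrite x0 /=; lia.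
  rewrite (gtn_eqF m0) /=; case: ltnP; lia.
by apply: IHn; rewrite // !inE eqxx orbT.
Qed.

(* The same as [tail_count], for an ascent sequence whose nonzero letters are
   1, 2, ..., m, to be extended avoiding 1100: a repeated nonzero letter
   leaves room for one more zero. *)
Fixpoint strict_count (b : bool) (n : nat) : nat :=
  if n is n'.+1 then
    strict_count true n' + tail_count 1 false b n' + strict_count false n'
  else 1.

Definition ok_with (ok : pred (seq nat)) (a l m : nat) (s : seq nat) : bool :=
  [&& asc_ok a l s, path leq m (nonzeros s) & ok s].

(** With slack 0 the next letter is 0, [m] or [m.+1]. Repeating [m] directly after a 0 gains an
    ascent without a larger letter, so the tail then starts with slack [l == 0], read as 0 or 1. *)
Lemma counted_strict (l m n : nat) : 0 < m -> l \in [:: 0; m] ->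
  counted (ok_with (ok1100 m) m l m) n (strict_count (l == 0) n).
Proof.
elim: n l m => [|n IHn] l m m0 l_m; first exact: counted0.
pose Q' x := if x == 0 then ok_with (ok1100 m) m 0 m
             else if x == m then tail_ok 1 (m + (l == 0)) m m
             else ok_with (ok1100 m.+1) m.+1 m.+1 m.+1.
pose c x := if x == 0 then strict_count true n
            else if x == m then tail_count 1 false (l == 0) n
            else strict_count false n.
have -> : strict_count (l == 0) n.+1 = \sum_(x <- [:: 0; m; m.+1]) c x.
  rewrite !big_cons big_nil /c /= (gtn_eqF m0) eqxx addn0 addnA.
  by rewrite (gtn_eqF (ltnSn m)).
apply: (counted_cons (Q' := Q')) => [|x s|x].
- by rewrite /= !inE andbT; lia.
- rewrite /Q' /ok_with !inE /=; case: (posnP x) => [-> | x0] /=.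
    by rewrite addn0.
  case: (eqVneq x m) => [-> | neq_xm] /=.
    rewrite leqnn leq_addr /tail_ok /=.
    have -> : (l < m) = (l == 0).
      by move: l_m; rewrite !inE => /orP[] /eqP ->; rewrite ?m0 // ltnn gtn_eqF.
    by [].
  case: (eqVneq x m.+1) => [-> | neq_xm1] /=.
    rewrite addn1 leqnn leqnSn /=.
    have -> : l < m.+1 by move: l_m; rewrite !inE => /orP[] /eqP ->.
    by rewrite addn1.
  by case: (leqP x (m + 1)) => //= le_x; case: (leqP m x) => /=; lia.
rewrite !inE /Q' /c; case: (posnP x) => [_ _ | x0] /=.
  by rewrite -[true]/(0 == 0); apply: IHn; rewrite // mem_head.
case: (eqVneq x m) => [_ _ | _ /= _].
  rewrite -[false](gtn_eqF m0).
  by apply: counted_tail; rewrite // !inE eqxx orbT.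
by rewrite -[false]/(m.+1 == 0); apply: IHn; rewrite // !inE eqxx orbT.
Qed.

Definition tail_countE :=
  (tail_countS, big_ord_recl, big_ord0, subn0, addn0, subnn, subSS).

(** This is where the counts for 1100 and 1000 meet. The second identity is exactly what the
    recurrences need for the induction step of the first, and it reproduces itself. *)
Lemma strict_count_tail_count (n : nat) :
  strict_count false n = tail_count 2 false 0 n /\
  strict_count true n + tail_count 1 false 0 n =
    tail_count 2 false 0 n + tail_count 1 true 0 n.
Proof.
elim: n => // n [IHf IHt].
rewrite ![strict_count _ n.+1]/= !tail_countE /= IHf.
lia.
Qed.

(** The first nonzero letter must be 1. The summand [c i] counts the words with [i] letters after
    it; the added one is the all-zero word. *)
Lemma counted_start (ok ok1 : pred (seq nat)) (c : nat -> nat) :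
  ok [::] -> (forall s, ok (0 :: s) = ok s) ->
  (forall s, ok (1 :: s) = ok1 s) ->
  (forall n, counted (ok_with ok1 1 1 1) n (c n)) ->
  forall n, counted (ok_with ok 0 0 0) n (\sum_(i < n) c i).+1.
Proof.
move=> ok_nil ok0 ok1E c1 n; elim: n => [|n IHn].
  by rewrite big_ord0; apply: counted0.
pose Q' x := if x == 0 then ok_with ok 0 0 0 else ok_with ok1 1 1 1.
have -> : (\sum_(i < n.+1) c i).+1 =
    \sum_(x <- [:: 0; 1]) if x == 0 then (\sum_(i < n) c i).+1 else c n.
  by rewrite big_ord_recr !big_cons big_nil /= addn0 addSn.
apply: (counted_cons (Q' := Q')) => // [[|[|x]] s | x].
- by rewrite /ok_with /Q' /= ok0.
- by rewrite /ok_with /Q' /= ok1E.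
- by [].
by rewrite !inE /Q' => /orP[] /eqP ->.
Qed.

(** * Cardinalities of the sets of avoiders *)

Lemma card_avoiders (t : seq nat) (n c : nat) :
  counted (fun s => [&& is_ascent_seq s, avoids s [:: 0; 2; 1] & avoids s t])
    n c ->
  #|avoiders t n| = c.
Proof.
case=> L [L_uniq <-] LP; rewrite cardE.
pose w (a : n.-tuple 'I_n) := [seq val i | i <- a].
have w_inj : injective w by move=> a b /(inj_map val_inj) /val_inj.
rewrite -(size_map w); apply/perm_size/uniq_perm => // [|s].
  by rewrite map_inj_uniq ?enum_uniq.
rewrite LP; apply/mapP/and4P => [[a] | [/eqP sz_s s_asc s_021 s_t]].
  rewrite mem_enum => a_av ->.
  have [|sz ? ? ?] := (avoidersP t n (w a)).1; first by exists a.
  by split=> //; apply/eqP.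
have [|a a_av def_s] := (avoidersP t n s).2; first by [].
by exists a; rewrite ?mem_enum // -def_s.
Qed.

Lemma card_avoiders0 (t : seq nat) : 0 < size t -> #|avoiders t 0| = 1.
Proof.
move=> t0; apply: card_avoiders; apply: counted0.
have av0 u : 0 < size u -> avoids [::] u.
  by case: u => // x u _; apply/containsP => -[v]; rewrite subseq0 => /eqP-> [].
by rewrite !av0 // !andbT; apply/forallP => -[].
Qed.

Lemma card_avoidersS (t : seq nat) (n : nat) :
  t = [:: 1; 0; 0; 0] \/ t = [:: 1; 1; 0; 0] ->
  #|avoiders t n.+1| = (\sum_(i < n) tail_count 2 false 0 i).+1.
Proof.
move=> t_eq; apply: card_avoiders.
suff [ok okE okP] : exists2 ok : pred (seq nat),
    forall s, sorted leq (nonzeros s) -> avoids (0 :: s) t = ok s &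
    counted (ok_with ok 0 0 0) n (\sum_(i < n) tail_count 2 false 0 i).+1.
  (* A sum over the single admissible first letter 0, in the shape of [counted_cons]. *)
  have -> : (\sum_(i < n) tail_count 2 false 0 i).+1 =
      \sum_(x <- [:: 0]) (\sum_(i < n) tail_count 2 false 0 i).+1.
    by rewrite big_seq1.
  apply: (counted_cons (Q' := fun=> ok_with ok 0 0 0)) => // x s.
  rewrite is_ascent_seq_cons inE; case: eqP => //= ->.
  rewrite /ok_with avoids021.
  rewrite path_min_sorted; last by apply/allP.
  by case: (asc_ok _ _ _) => //=; case: (boolP (sorted _ _)) => // /okE.
case: t_eq => ->.
  exists ok1000; first exact: avoids1000.
  apply: (counted_start (ok1 := fun s => count_mem 0 s <= 2)) => // i.
  exact: (@counted_tail 2 0 1 1).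
exists (ok1100 0); first exact: avoids1100.
apply: (counted_start (ok1 := ok1100 1)) => // i.
rewrite -(strict_count_tail_count i).1; exact: (@counted_strict 1 1).
Qed.

(** * Algebra of formal power series *)

Local Open Scope ring_scope.

(** Coefficients up to [n] depend only on truncations, so commutativity and associativity come from
    polynomials. *)
Lemma fps_mul_trunc (R : comNzRingType) (f g : fps R) (n m : nat) :
  (m <= n)%N ->
  fps_mul f g m = ((\poly_(i < n.+1) f i) * (\poly_(i < n.+1) g i))`_m.
Proof.
move=> le_mn; rewrite coefM; apply: eq_bigr => i _.
have lt_i := ltn_ord i; rewrite !coef_poly !ifT //; lia.
Qed.

Lemma fps_mulC (R : comNzRingType) (f g : fps R) : fps_mul f g =1 fps_mul g f.
Proof. by move=> n; rewrite !(fps_mul_trunc _ _ (leqnn n)) mulrC. Qed.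

Lemma fps_mulA (R : comNzRingType) (f g h : fps R) :
  fps_mul f (fps_mul g h) =1 fps_mul (fps_mul f g) h.
Proof.
move=> n; set t := fun f : fps R => \poly_(i < n.+1) f i.
transitivity ((t f * (t g * t h))`_n); last first.
  rewrite mulrA coefM; apply: eq_bigr => i _.
  have lt_i := ltn_ord i; rewrite -fps_mul_trunc ?coef_poly ?ifT //; lia.
rewrite coefM; apply: eq_bigr => i _.
have lt_i := ltn_ord i; rewrite -fps_mul_trunc ?coef_poly ?ifT //; lia.
Qed.

Lemma fps_div_unique (F : fieldType) (f g p : fps F) :
  g 0%N != 0 -> fps_mul f g =1 p -> f =1 fps_div p g.
Proof.
move=> g0 fgE n; transitivity (fps_mul f (fps_mul g (fps_inv g)) n).
  rewrite /fps_mul big_ord_recr /= subnn.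
  (* Only the last term of the convolution survives, because [g] times its inverse is 1. *)
  rewrite big1 ?add0r => [|i _].
    rewrite [X in _ * X](fps_mulC g _ 0%N) fps_mulVf //.
    by rewrite /fps_poly coef1 mulr1.
  rewrite [X in _ * X](fps_mulC g _ (n - i)%N) fps_mulVf // /fps_poly coef1.
  by rewrite gtn_eqF ?subn_gt0 // mulr0.
by rewrite fps_mulA /fps_div; apply: eq_bigr => i _; rewrite fgE.
Qed.

(** For fixed [k] this is a linear recurrence with [k] terms; [k <= n.+1] keeps [n - i] from
    truncating. *)
Lemma fps_mul_poly (R : comNzRingType) (f : fps R) (p : {poly R}) (k n : nat) :
  (size p <= k <= n.+1)%N ->
  fps_mul f (fps_poly p) n = \sum_(i < k) p`_i * f (n - i)%N.
Proof.
move=> /andP[le_pk le_kn]; rewrite fps_mulC /fps_mul /fps_poly.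
rewrite (big_ord_widen _ (fun i => p`_i * f (n - i)%N) le_kn) big_mkcond /=.
rewrite [RHS]big_mkcond; apply: eq_bigr => i _ /=.
by case: ltnP => // le_ki; rewrite nth_default ?mul0r // (leq_trans le_pk).
Qed.

(** * Recurrences and closed forms for the states reachable from [tail_count 2 false 0] *)

Arguments tail_count : simpl never.

Lemma tail_count0 (k e : nat) (b : bool) : tail_count k b e 0 = 1%N.
Proof. by []. Qed.

Local Notation tail k b e n := ((tail_count k b e n)%:R : rat).

(** Each zero uses up one of two and raises the slack by at most 1, so slacks 0, 1 and 2 suffice
    here and in the next recurrences. *)
Lemma tail_false0 (k n : nat) :
  tail k false 0 n.+1 = (tail k false 0 n + tail k false 0 n +
    (if k is k'.+1 then tail k' true 0 n else 0)).
Proof.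
rewrite tail_countS !big_ord_recl big_ord0 addn0 !natrD ?addrA.
by case: k.
Qed.

Lemma tail_false1 (k n : nat) :
  tail k false 1 n.+1 =
    (tail k false 1 n + tail k false 1 n + tail k false 0 n +
     (if k is k'.+1 then tail k' true 1 n else 0)).
Proof.
rewrite tail_countS !big_ord_recl big_ord0 addn0 !natrD ?addrA.
by case: k.
Qed.

Lemma tail_false2 (k n : nat) :
  tail k false 2 n.+1 =
    (tail k false 2 n + tail k false 2 n + tail k false 1 n + tail k false 0 n +
     (if k is k'.+1 then tail k' true 2 n else 0)).
Proof.
rewrite tail_countS !big_ord_recl big_ord0 addn0 !natrD ?addrA.
by case: k.
Qed.

Lemma tail_true0 (k n : nat) :
  tail k true 0 n.+1 =
    (tail k false 1 n + tail k false 0 n +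
     (if k is k'.+1 then tail k' true 0 n else 0)).
Proof.
rewrite tail_countS !big_ord_recl big_ord0 addn0 !natrD ?addrA.
by case: k.
Qed.

Lemma tail_true1 (k n : nat) :
  tail k true 1 n.+1 =
    (tail k false 2 n + tail k false 1 n + tail k false 0 n +
     (if k is k'.+1 then tail k' true 1 n else 0)).
Proof.
rewrite tail_countS !big_ord_recl big_ord0 addn0 !natrD ?addrA.
by case: k.
Qed.

Lemma tail_k0e0 n : tail 0 false 0 n = 2 ^+ n.
Proof. by elim: n => // n IHn; rewrite tail_false0 /= IHn exprS; ring. Qed.

Lemma tail_k0e1 n : tail 0 false 1 n = 2 ^+ n * (1 + n%:R / 2).
Proof.
elim: n => [|n IHn]; first by rewrite /= ?tail_count0 expr0; field.
by rewrite tail_false1 /= IHn tail_k0e0 ![2 ^+ _.+1]exprS; field.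
Qed.

Lemma tail_k0e2 n :
  tail 0 false 2 n = 2 ^+ n * (1 + 7 * n%:R / 8 + n%:R ^+ 2 / 8).
Proof.
elim: n => [|n IHn]; first by rewrite /= ?tail_count0 expr0; field.
by rewrite tail_false2 /= IHn tail_k0e1 tail_k0e0 ![2 ^+ _.+1]exprS; field.
Qed.

(** The shift is needed: states ending in 0 do not return to themselves, and this eigenvalue 0
    spoils the formula at length 0. *)
Lemma tail_k1e0 n :
  tail 1 false 0 n.+1 = 2 ^+ n * (3 + 7 * n%:R / 8 + n%:R ^+ 2 / 8).
Proof.
elim: n => [|n IHn]; first by rewrite tail_false0 /= ?tail_count0 expr0; field.
rewrite tail_false0 /= IHn tail_true0 /= tail_k0e1 tail_k0e0.
by rewrite ![2 ^+ _.+1]exprS; field.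
Qed.

Lemma tail_k1e1 n :
  tail 1 false 1 n =
    2 ^+ n * (1 + 19 * n%:R / 24 + 3 * n%:R ^+ 2 / 16 + n%:R ^+ 3 / 48).
Proof.
(* Two base cases, since [tail_k1e0] and [tail_true1] require positive length. *)
elim: n => [|[|n] IHn]; first by rewrite /= ?tail_count0 expr0; field.
  by rewrite tail_false1 /= ?tail_count0; field.
rewrite tail_false1 /= IHn tail_k1e0 tail_true1 /= tail_k0e2 tail_k0e1 tail_k0e0.
by rewrite ![2 ^+ _.+1]exprS; field.
Qed.

Lemma tail_k2e0 n :
  tail 2 false 0 n.+2 =
    2 ^+ n * (9 + 115 * n%:R / 32 + 155 * n%:R ^+ 2 / 192
              + 3 * n%:R ^+ 3 / 32 + n%:R ^+ 4 / 192).
Proof.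
elim: n => [|n IHn].
  by rewrite tail_false0 tail_true0 /= !tail_count0 expr0; field.
rewrite tail_false0 /= IHn tail_true0 /= tail_k1e1 tail_k1e0 tail_true0.
by rewrite tail_k0e1 tail_k0e0 ![2 ^+ _.+1]exprS; field.
Qed.

Lemma sum_tail_k2e0 n :
  (\sum_(i < n.+2) tail_count 2 false 0 i).+1%:R =
    2 ^+ n * (5 + 145 * n%:R / 96 + 83 * n%:R ^+ 2 / 192
              + 5 * n%:R ^+ 3 / 96 + n%:R ^+ 4 / 192) :> rat.
Proof.
elim: n => [|n IHn].
  rewrite !big_ord_recr big_ord0 /= tail_count0 add0n -addSn natrD.
  by rewrite tail_false0 /= !tail_count0 expr0; field.
by rewrite big_ord_recr /= -addSn natrD IHn tail_k2e0 ![2 ^+ _.+1]exprS; field.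
Qed.

(** * Comparison with the rational function *)

Lemma num_Poly :
  (1 - 'X) * (1 - 8 *: 'X + 24 *: 'X^2 - 31 *: 'X^3 + 13 *: 'X^4
              + 2 *: 'X^5 + 2 *: 'X^6)
  = Poly [:: 1; -9; 32; -55; 44; -11; 0; -2] :> {poly rat}.
Proof. by rewrite /= !cons_poly_def -!mul_polyC; ring. Qed.

Lemma den_Poly :
  (1 - 2 *: 'X) ^+ 5 = Poly [:: 1; -10; 40; -80; 80; -32] :> {poly rat}.
Proof. by rewrite /= !cons_poly_def -!mul_polyC; ring. Qed.

Theorem theorem2p4 (tau : seq nat)
    (htau : tau = [:: 1; 0; 0; 0]%N \/ tau = [:: 1; 1; 0; 0]%N) :
  avoiders_gf tau =1
  fps_div
    (fps_poly ((1 - 'X) *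
       (1 - 8 *: 'X + 24 *: 'X^2 - 31 *: 'X^3 + 13 *: 'X^4
          + 2 *: 'X^5 + 2 *: 'X^6)))
    (fps_poly ((1 - 2 *: 'X) ^+ 5)).
Proof.
have f0 : avoiders_gf tau 0%N = 1.
  by rewrite /avoiders_gf card_avoiders0 //; case: htau => ->.
have f1 : avoiders_gf tau 1%N = 1.
  by rewrite /avoiders_gf card_avoidersS // big_ord0.
have f2 : avoiders_gf tau 2%N = 2.
  by rewrite /avoiders_gf card_avoidersS // big_ord_recl big_ord0.
(* The numerator has degree 7 and the denominator degree 5, so the quotient has a polynomial part of
   degree 2 and the closed form starts at length 3. *)
have f3 n : avoiders_gf tau n.+3 =
    2 ^+ n * (5 + 145 * n%:R / 96 + 83 * n%:R ^+ 2 / 192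
              + 5 * n%:R ^+ 3 / 96 + n%:R ^+ 4 / 192).
  by rewrite /avoiders_gf card_avoidersS // sum_tail_k2e0.
rewrite num_Poly den_Poly; apply: fps_div_unique => [|n].
  by rewrite /fps_poly coef_Poly.
move: (avoiders_gf tau) f0 f1 f2 f3 => f f0 f1 f2 f3.
rewrite [RHS]/fps_poly [in RHS]coef_Poly.
(* From degree 5 on, all six coefficients of the denominator enter the convolution; lower degrees
   are expanded directly. *)
case: (ltnP n 5) => [|/subnKC <-].
  rewrite /fps_mul /fps_poly.
  case: n => [|[|[|[|[|//]]]]] _;
    rewrite !big_ord_recl big_ord0 !coef_Poly /= /bump /=.
  - by rewrite f0; ring.
  - by rewrite f0 f1; ring.
  - by rewrite f0 f1 f2; ring.
  - by rewrite f0 f1 f2 f3 expr0; field.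
  - by rewrite f0 f1 f2 !f3 expr0; field.
move: (n - 5)%N => {}n.
rewrite (@fps_mul_poly _ _ _ 6); last by rewrite (leq_trans (size_Poly _)).
rewrite !big_ord_recl big_ord0 !coef_Poly /= /bump /=.
rewrite !addSn !add0n ?subSS subn0.
(* In degrees 5, 6 and 7 the recurrence still reaches the initial values [f0], [f1], [f2]; beyond,
   the numerator vanishes and [f3] covers every term. *)
case: n => [|[|[|n]]] /=.
- by rewrite !f3 f0 f1 f2 expr0; field.
- by rewrite !f3 f1 f2 expr0; field.
- by rewrite !f3 f2 expr0; field.
by rewrite !f3 ![2 ^+ _.+1]exprS nth_nil; field.
Qed.
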